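(* If the marginal distribution $f$ is a centered Laplace distribution with score $l'(z)=-\kappa\,\mathrm{sgn}(z)$, then the approximate risk $\hat R$ of $\hat\theta_{\mathrm{GEST}}$ is minimized if and only if \[ t(|Z|)=\kappa\qquad\text{and}\qquad c(|Z|)=1 . \] In this case, the realized (positive-part truncated) estimator is the lasso soft-thresholding rule with threshold $\lambda=\kappa$, namely \[ \hat\theta_{\mathrm{NOMAD}}=\hat\theta_{\mathrm{lasso}}=\Bigl(1-\frac{\lambda}{|Z|}\Bigr)_+\circ Z . \]
   Context: Model: $Z\sim N(\theta,I_d)$; the observed value of $Z$ is written $\check z$ (and the statement's $Z$ is the observation). For $z\in\mathbb R^d$, $|z|=(|z_1|,\dots,|z_d|)$; $\circ$ is the Hadamard product and operations on vectors are coordinatewise. $f$ is the coordinatewise marginal density and $l'=(\log f)'$. For functionals $t,c\ge0$ the untruncated GEST estimator has coordinates $\hat\theta_{\mathrm{GEST},i}=\bigl(1-t(|Z|)/|Z_i|^{c(|Z|)}\bigr)Z_i$; its truncated version replaces the multiplier by its positive part. The approximate risk is $\hat R(t,c;\check z)=d+\int_{\mathbb R^d}\hat H\,dz$ with \[ \hat H=-\sum_{i=1}^d\frac{1}{|z_i|^{c}}\Bigl(2|z_i|\frac{\partial t}{\partial|z_i|}-2t|z_i|\ln|z_i|\frac{\partial c}{\partial|z_i|}+2t(1-c)-t^2|z_i|^{2-c}\Bigr)\prod_{j=1}^d\phi\bigl(z_j-\check z_j-l'(\check z_j)\bigr), \] $t=t(|z|)$, $c=c(|z|)$, $\phi$ the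 standard normal density; it is minimized over the class $\mathcal F$ of pairs $(t,c)$ whose partial derivatives exist a.e. and for which these integrals are well defined. Minimizers are characterized in the paper by the optimality conditions (at $\check z$, with $c=c(|\check z|)$) \[ t(|\check z|)=-\frac{\sum_i\mathrm{sgn}(\check z_i)|\check z_i|^{1-c}l'(\check z_i)}{\sum_i|\check z_i|^{2-2c}},\qquad \frac{\sum_i\mathrm{sgn}(\check z_i)|\check z_i|^{1-c}l'(\check z_i)}{\sum_i|\check z_i|^{2-2c}}=\frac{\sum_i\mathrm{sgn}(\check z_i)|\check z_i|^{1-c}\ln|\check z_i|\,l'(\check z_i)}{\sum_i|\check z_i|^{2-2c}\ln|\check z_i|}. \] The NOMAD estimator is the GEST estimator with $(t,c)$ equal to the approximate-risk minimizer.
   Formalization: ''Minimized'' is read via the paper's optimality conditions (also the Euler-Lagrange equations), as no literal minimizer over F exists; and Z is assumed to have nonzero coordinates, |Z_i| not all equal (so d ≥ 2) and Σ ln|Z_i| ≠ 0, since otherwise the equivalence is false or undefined. *)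

(* Defs.v *)
(* MathComp / MathComp-Analysis *)
From HB Require Import structures.
From mathcomp Require Import all_boot all_order all_algebra.
From mathcomp Require Import all_classical all_reals all_analysis.
Set Implicit Arguments.
Unset Strict Implicit.
Unset Printing Implicit Defensive.
Import Order.TTheory GRing.Theory Num.Theory.
Import numFieldNormedType.Exports.

Local Open Scope classical_set_scope.
Local Open Scope ring_scope.

Section lebesgue_tuple.
Context {R : realType}.

Definition tuple_cons (n : nat) (p : R * n.-tuple R) : n.+1.-tuple R :=
  cons_tuple p.1 p.2.

Lemma measurable_tuple_cons (n : nat) :
  measurable_fun [set: R * n.-tuple R] (@tuple_cons n).
Proof. exact: measurable_cons. Qed.

Section step.
Variables (n : nat) (m : {sigma_finite_measure set (n.-tuple R) -> \bar R}).

Definition lebesgue_cons : set (n.+1.-tuple R) -> \bar R :=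
  pushforward (@lebesgue_measure R \x m)%E (@tuple_cons n).

Let mcons := @measurable_tuple_cons n.

Let lebesgue_cons0 : lebesgue_cons set0 = 0%E.
Proof. by rewrite /lebesgue_cons /pushforward preimage_set0 measure0. Qed.

Let lebesgue_cons_ge0 A : (0 <= lebesgue_cons A)%E.
Proof. exact: measure_ge0. Qed.

Let lebesgue_cons_sigma_additive : semi_sigma_additive lebesgue_cons.
Proof.
move=> F mF tF mUF; rewrite /lebesgue_cons /pushforward preimage_bigcup.
apply: measure_semi_sigma_additive.
- by move=> i; rewrite -[X in measurable X]setTI; exact: mcons.
- apply/trivIsetP => /= i j _ _ ij; rewrite -preimage_setI.
  by move/trivIsetP : tF => /(_ _ _ _ _ ij) ->//; rewrite preimage_set0.
- by rewrite -preimage_bigcup -[X in measurable X]setTI; exact: mcons.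
Qed.

HB.instance Definition _ := isMeasure.Build _ _ _ lebesgue_cons
  lebesgue_cons0 lebesgue_cons_ge0 lebesgue_cons_sigma_additive.

Let lebesgue_cons_sigma_finite : sigma_finite setT lebesgue_cons.
Proof.
pose uncons (u : n.+1.-tuple R) : R * n.-tuple R := (thead u, [tuple of behead u]).
have unconsK : cancel (@tuple_cons n) uncons.
  by case=> x v; rewrite /uncons /= theadE; congr pair; exact: val_inj.
have muncons : measurable_fun setT uncons.
  by apply: measurable_fun_pair; [exact: measurable_tnth|exact: measurable_behead].
have /sigma_finiteP[F [TF ndF Foo]] := sigma_finiteT (@lebesgue_measure R).
have /sigma_finiteP[G [TG ndG Goo]] := sigma_finiteT m.
have consK k : @tuple_cons n @^-1` (uncons @^-1` (F k `*` G k)) = F k `*` G k.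
  by rewrite -comp_preimage (_ : _ \o _ = id) //; exact/funext.
exists (fun k => uncons @^-1` (F k `*` G k)).
  rewrite -preimage_bigcup -[LHS](preimage_setT uncons); congr (_ @^-1` _).
  rewrite -setXTT TF TG predeqE => -[x y]; split.
    move=> [/= [i _ Fix] [k _ Gky]]; exists (maxn i k) => //; split.
    - by move: x Fix; exact/subsetPset/ndF/leq_maxl.
    - by move: y Gky; exact/subsetPset/ndG/leq_maxr.
  by move=> [i _ []/= ? ?]; split; exists i.
move=> k; have [mF Fk] := Foo k; have [mG Gk] := Goo k; split.
  rewrite -[X in measurable X]setTI; apply: muncons => //.
  exact: measurableX.
rewrite /lebesgue_cons /pushforward consK product_measure1E//.
by rewrite lte_mul_pinfty// ge0_fin_numE.
Qed.

HB.instance Definition _ := Measure_isSigmaFinite.Build _ _ _ lebesgue_cons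
  lebesgue_cons_sigma_finite.

End step.

Fixpoint lebesgue_tuple (n : nat) :
    {sigma_finite_measure set (n.-tuple R) -> \bar R} :=
  match n with
  | 0%N => \d_([tuple] : 0.-tuple R)
  | n'.+1 => lebesgue_cons (lebesgue_tuple n')
  end.

End lebesgue_tuple.

Section gest.
Context {R : realType} {d : nat}.
Implicit Types (f : R -> R) (z zobs a p q th : 'rV[R]_d) (t c : 'rV[R]_d -> R).

Definition score f : R -> R := derive1 (fun x => ln (f x)).

Definition laplace_pdf (kappa x : R) : R := kappa / 2 * expR (- (kappa * `|x|)).

Definition vabs z : 'rV[R]_d := map_mx Num.norm z.

Definition hadamard z z' : 'rV[R]_d := map2_mx *%R z z'.

(* A functional of |z| is a function on 'rV[R]_d of which only the values on
   the nonnegative orthant matter; its partial derivative with respect to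
   |z_i| is the derivative along the i-th basis vector at the point |z|. *)
Definition basis_vec (i : 'I_d) : 'rV[R]_d := delta_mx 0 i.

Definition grad t a : 'rV[R]_d := \row_i 'D_(basis_vec i) t a.

Definition has_partials t a := forall i, derivable t a (basis_vec i).

Definition gest t c z : 'rV[R]_d :=
  \row_i ((1 - t (vabs z) / `|z 0 i| `^ c (vabs z)) * z 0 i).

Definition gest_plus t c z : 'rV[R]_d :=
  \row_i (Num.max 0 (1 - t (vabs z) / `|z 0 i| `^ c (vabs z)) * z 0 i).

Definition soft_threshold (lambda : R) z : 'rV[R]_d :=
  \row_i (Num.sg (z 0 i) * Num.max 0 (`|z 0 i| - lambda)).

(* The integrand of the approximate risk, as a function of the integration
   variable z and of independent arguments standing for t, c and their
   gradients at |z|, so that it can serve as a Lagrangian. *)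
Definition risk_lagrangian f zobs z (tau gamma : R) p q : R :=
  - (\sum_i (`|z 0 i| `^ gamma)^-1 *
      (2 * `|z 0 i| * p 0 i - 2 * tau * `|z 0 i| * ln `|z 0 i| * q 0 i
       + 2 * tau * (1 - gamma) - tau ^+ 2 * `|z 0 i| `^ (2 - gamma)))
  * \prod_j normal_pdf 0 1 (z 0 j - zobs 0 j - score f (zobs 0 j)).

Definition Hhat f zobs t c z : R :=
  risk_lagrangian f zobs z (t (vabs z)) (c (vabs z))
    (grad t (vabs z)) (grad c (vabs z)).

Definition row_of_tuple (u : d.-tuple R) : 'rV[R]_d := \row_i tnth u i.

Definition approx_risk f zobs t c : \bar R :=
  (d%:R%:E + \int[lebesgue_tuple d]_u (Hhat f zobs t c (row_of_tuple u))%:E)%E.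

Definition gest_class f zobs : set (('rV[R]_d -> R) * ('rV[R]_d -> R)) :=
  [set tc | [/\ forall z, 0 <= tc.1 (vabs z) /\ 0 <= tc.2 (vabs z),
     {ae lebesgue_tuple d, forall u, has_partials tc.1 (vabs (row_of_tuple u))
        /\ has_partials tc.2 (vabs (row_of_tuple u))} &
     (lebesgue_tuple d).-integrable setT
       (fun u => (Hhat f zobs tc.1 tc.2 (row_of_tuple u))%:E)]].

Definition risk_minimizer f zobs
    (G : set (('rV[R]_d -> R) * ('rV[R]_d -> R))) t c : Prop :=
  G (t, c) /\ forall t' c', G (t', c') ->
    (approx_risk f zobs t c <= approx_risk f zobs t' c')%E.

Definition optimality_conditions f zobs t c : Prop :=
  let a := vabs zobs in
  let S1 := \sum_i Num.sg (zobs 0 i) * a 0 i `^ (1 - c a) * score f (zobs 0 i) in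
  let S2 := \sum_i a 0 i `^ (2 - 2 * c a) in
  let S1ln := \sum_i Num.sg (zobs 0 i) * a 0 i `^ (1 - c a) * ln (a 0 i)
                     * score f (zobs 0 i) in
  let S2ln := \sum_i a 0 i `^ (2 - 2 * c a) * ln (a 0 i) in
  t a = - (S1 / S2) /\ S1 / S2 = S1ln / S2ln.

(* Minimizers of the approximate risk enter the NOMAD estimator through the
   optimality conditions that characterize them. *)
Definition nomad_estimate f zobs th : Prop :=
  exists t c, [/\ gest_class f zobs (t, c), optimality_conditions f zobs t c &
                  th = gest_plus t c zobs].

(* Varying |z_i| with the sign of z_i fixed is moving z along this vector. *)
Definition radial_dir zobs (i : 'I_d) : 'rV[R]_d :=
  Num.sg (zobs 0 i) *: basis_vec i.

(* The Euler-Lagrange equations of the approximate risk in t and in c, with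
   independent variables |z_1|, ..., |z_d|, taken at z = zobs. *)
Definition euler_lagrange f zobs t c : Prop :=
  let L z := risk_lagrangian f zobs z in
  let a := vabs zobs in
  let dLdp i z := 'D_(basis_vec i)
    (fun p => L z (t (vabs z)) (c (vabs z)) p (grad c (vabs z)))
    (grad t (vabs z)) in
  let dLdq i z := 'D_(basis_vec i)
    (fun q => L z (t (vabs z)) (c (vabs z)) (grad t (vabs z)) q)
    (grad c (vabs z)) in
  derive1 (fun tau => L zobs tau (c a) (grad t a) (grad c a)) (t a)
    = \sum_i 'D_(radial_dir zobs i) (dLdp i) zobs /\
  derive1 (fun gamma => L zobs (t a) gamma (grad t a) (grad c a)) (c a)
    = \sum_i 'D_(radial_dir zobs i) (dLdq i) zobs.

(* Conditions that fail only on a null set of observations when d >= 2.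
   When all |z_i| coincide (in particular when d = 1) the optimality conditions
   do not determine c; the last inequation is the nonvanishing at c = 1 of the
   denominator sum_i |z_i|^(2-2c) ln |z_i|. *)
Definition generic_observation zobs : Prop :=
  [/\ forall i, zobs 0 i != 0,
      exists i j, `|zobs 0 i| != `|zobs 0 j| &
      \sum_i ln `|zobs 0 i| != 0].

End gest.

(* Main.v *)
(* At the observation put x_i = |z_i|^(1-c), with score -kappa sgn z_i.  Both the
   optimality conditions and the Euler-Lagrange equations reduce to
     t sum_i x_i^2 = kappa sum_i x_i  and
     t sum_i x_i^2 ln |z_i| = kappa sum_i x_i ln |z_i|
   (in the Euler-Lagrange case the partial derivatives of t and c cancel, because
   the radial logarithmic derivative of the Gaussian factor at z is -kappa).
   Eliminating t and kappa gives
     sum_(i, j) x_i x_j (x_j - x_i) (ln |z_j| - ln |z_i|) = 0;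
   multiplied by 1 - c, every summand is nonnegative, and one is positive unless
   c = 1 or all |z_i| agree.  Hence c = 1, and then t = kappa.  The constant pair
   (kappa, 1) lies in the class because its integrand is dominated by a product of
   Gaussian densities, which is integrable by Tonelli. *)
Require Import Defs.
From HB Require Import structures.
From mathcomp Require Import all_boot all_order all_algebra.
From mathcomp Require Import ring.
From mathcomp Require Import all_classical all_reals all_analysis.
From mathcomp Require Import measurable_realfun.
Import Order.TTheory GRing.Theory Num.Theory.
Import numFieldNormedType.Exports.
Local Open Scope classical_set_scope.
Local Open Scope ring_scope.

(** * Directional derivatives and the one-variable derivatives they reduce to *)

(** Both sides have literally the same difference quotient. Restricting to a line makes the
    one-variable chain and product rules available for directional derivatives. *)
Lemma is_derive_line {R : realType} {V : normedModType R} (g : V -> R) (x v : V)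
  (y : R) :
  is_derive x v g y <-> is_derive (0 : R) 1 (fun h : R => g (h *: v + x)) y.
Proof.
have quotE : (fun h : R => h^-1 *: ((g \o shift x) (h *: v) - g x)) =
    (fun h : R => h^-1 *: (((fun k : R => g (k *: v + x)) \o shift 0) (h *: 1)
                           - g (0 *: v + x))).
  apply/funext => h /=; congr (_ *: (g (_ + _) - g _)).
    by congr (_ *: _); rewrite addr0; exact/esym/mulr1.
  by rewrite scale0r add0r.
split=> -[dg <-]; split.
- by rewrite /derivable -quotE.
- by rewrite /derive -quotE.
- by rewrite /derivable quotE.
- by rewrite /derive quotE.
Qed.

(** Meant for the Lagrangian as a function of one of its gradient arguments, in which it is
    affine. *)
Lemma derive_affine {R : realType} {V : normedModType R} (g : V -> R) (x v : V)
  (k : R) :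
  (forall h : R, g (h *: v + x) = g x + h * k) -> 'D_v g x = k.
Proof.
move=> gE; apply: derive_val; apply/is_derive_line.
rewrite (_ : (fun h => _) = cst (g x) + (k \*: id : R -> R)); last first.
  by apply/funext => h; rewrite gE mulrC.
by apply: is_derive_eq; rewrite add0r; exact: mulr1.
Qed.

Lemma is_derive_ln_shift {R : realType} (A : R) : 0 < A ->
  is_derive (0 : R) 1 (fun h : R => ln (A + h)) A^-1.
Proof.
move=> A0.
have dA : is_derive (0 : R) 1 (cst A + id : R -> R) 1.
  by apply: is_derive_eq; rewrite add0r.
have lnA : is_derive ((cst A + id : R -> R) 0) 1 (@ln R) A^-1.
  by rewrite /= [_ 0]addr0; exact: is_derive1_ln.
have := is_derive1_comp lnA dA.
by rewrite mulr1.
Qed.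

(* The last factor is the Gaussian density along a radial line, up to a constant. *)
Lemma is_derive_radial {R : realType} (A kappa q : R) (C : R -> R) : 0 < A ->
  is_derive (0 : R) 1 C q ->
  is_derive (0 : R) 1 (fun h : R => (A + h) * expR (- (C h * ln (A + h)))
                             * expR (- (h ^+ 2 / 2 + kappa * h)))
    (expR (- (C 0 * ln A)) * (1 - C 0 - A * ln A * q - kappa * A)).
Proof.
move=> A0 dC.
have dA : is_derive (0 : R) 1 (cst A + id : R -> R) 1.
  by apply: is_derive_eq; rewrite add0r.
have dln := is_derive_ln_shift A A0.
have dCl := is_deriveN (is_deriveM dC dln).
have dE := is_derive1_comp (is_derive_expR _) dCl.
have dQ : is_derive (0 : R) 1 (- (2^-1 \*: (id ^+ 2) + kappa \*: id) : R -> R) (- kappa).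
  apply: is_derive_eq.
  transitivity (- (2^-1 * (2 * 0 ^+ 1 * 1) + kappa * 1) : R) => //; ring.
have dG := is_derive1_comp (is_derive_expR _) dQ.
have dF := is_deriveM (is_deriveM dA dE) dG.
set F := (F in is_derive _ _ F _) in dF.
rewrite (_ : (fun h => _) = F); last first.
  apply/funext => h; rewrite /F.
  congr (_ * _ * expR (- _)).
  by rewrite mulrC.
apply: is_derive_eq.
pose E0 := expR (- (C 0 * ln (A + 0))).
pose G0 := expR (- (2^-1 * (0 : R) ^+ 2 + kappa * 0)).
transitivity ((A + 0) * E0 * (G0 * - kappa)
  + G0 * ((A + 0) * (E0 * - (C 0 * A^-1 + ln (A + 0) * q)) + E0 * 1)) => //.
have -> : G0 = 1 by rewrite /G0 expr0n mulr0 mulr0 addr0 oppr0 expR0.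
rewrite /E0 addr0; field; exact: lt0r_neq0.
Qed.

Lemma is_derive_sum_fun {R : realType} {n : nat} (F : 'I_n -> R -> R)
  (dF : 'I_n -> R) (x : R) :
  (forall i, is_derive x 1 (F i) (dF i)) ->
  is_derive x 1 (fun y => \sum_(i < n) F i y) (\sum_(i < n) dF i).
Proof. by move=> /is_derive_sum; rewrite fct_sumE. Qed.

Lemma is_derive_quadratic {R : realType} (u v w x : R) :
  is_derive x 1 (fun y : R => u + v * y + w * y ^+ 2) (v + 2 * w * x).
Proof.
pose F : R -> R := cst u + v \*: id + w \*: (id ^+ 2).
have dF : is_derive x 1 F (v + 2 * w * x).
  apply: is_derive_eq.
  transitivity (0 + v * 1 + w * (2 * x ^+ 1 * 1)) => //; ring.
exact: dF.
Qed.

(** With E(y) = exp(- y ln A), the function is E(y) times an affine function of y, minus tau^2 A^2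
    E(y)^2, so the product rule suffices. *)
Lemma is_derive_powR_term {R : realType} (A K tau x : R) : 0 < A ->
  is_derive x 1 (fun y : R => (A `^ y)^-1 *
      (K + 2 * tau * (1 - y) - tau ^+ 2 * A `^ (2 - y)))
    (- ln A * (A `^ x)^-1 * (K + 2 * tau * (1 - x)) - 2 * tau * (A `^ x)^-1
     + 2 * ln A * tau ^+ 2 * (A * (A `^ x)^-1) ^+ 2).
Proof.
move=> A0.
have dl : is_derive x 1 ((- ln A) \*: id : R -> R) (- ln A).
  by apply: is_derive_eq; exact: mulr1.
have de := is_derive1_comp (is_derive_expR _) dl.
have dq := is_derive_quadratic (K + 2 * tau) (- (2 * tau)) 0 x.
have := is_deriveB (is_deriveM de dq) (is_deriveZ (tau ^+ 2 * A ^+ 2) (is_deriveM de de)).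
set F := (F in is_derive _ _ F _ -> _); set y := (y in is_derive _ _ _ y -> _).
have EE u : expR (- ln A * u) = (A `^ u)^-1.
  by rewrite mulNr expRN /powR gt_eqF// [ln A * u]mulrC.
have -> : F = (fun y : R => (A `^ y)^-1 *
      (K + 2 * tau * (1 - y) - tau ^+ 2 * A `^ (2 - y))).
  apply/funext => u; rewrite powRB ?(gt_eqF A0) ?implybT// -EE.
  rewrite (_ : A `^ 2 = A ^+ 2); last by rewrite -powR_mulrn// ltW.
  rewrite -[LHS]/(expR (- ln A * u) * (K + 2 * tau + - (2 * tau) * u + 0 * u ^+ 2)
     - tau ^+ 2 * A ^+ 2 * (expR (- ln A * u) * expR (- ln A * u))).
  ring.
congr (is_derive _ _ _ _); rewrite /y -EE.
transitivity (expR (- ln A * x) * (- (2 * tau) + 2 * 0 * x)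
  + (K + 2 * tau + - (2 * tau) * x + 0 * x ^+ 2) * (expR (- ln A * x) * - ln A)
  - tau ^+ 2 * A ^+ 2 * (expR (- ln A * x) * (expR (- ln A * x) * - ln A)
      + expR (- ln A * x) * (expR (- ln A * x) * - ln A))) => //.
ring.
Qed.

(** The log-density is a constant minus kappa |y|, and near a nonzero x the sign of y is constant,
    so it is locally affine. *)
Lemma score_laplace {R : realType} (kappa x : R) : 0 < kappa -> x != 0 ->
  score (laplace_pdf kappa) x = - (kappa * Num.sg x).
Proof.
move=> kappa0 x0; rewrite /score derive1E.
have lnpdf y : ln (laplace_pdf kappa y) = ln (kappa / 2) - kappa * `|y|.
  by rewrite /laplace_pdf lnM ?posrE ?expR_gt0 ?divr_gt0// expRK.
rewrite (_ : (fun y => _) = (fun y => ln (kappa / 2) - kappa * `|y|)); last first.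
  exact/funext.
have sg_near : \forall y \near x, Num.sg y = Num.sg x.
  have /orP[x_lt0|x_gt0] : (x < 0) || (0 < x) by rewrite -neq_lt.
    by near=> y; rewrite !ltr0_sg//; near: y; exact: lt_nbhsl.
  by near=> y; rewrite !gtr0_sg//; near: y; exact: lt_nbhsr.
pose g : R -> R := cst (ln (kappa / 2)) + (- (kappa * Num.sg x)) \*: id.
have dg : is_derive x 1 g (- (kappa * Num.sg x)).
  by apply: is_derive_eq; rewrite add0r; exact: mulr1.
apply: derive_val; apply: near_eq_is_derive dg.
near=> y; have sgy : Num.sg y = Num.sg x by near: y.
rewrite [LHS]/(ln (kappa / 2) + - (kappa * Num.sg x) * y) normrEsg sgy.
by rewrite mulNr mulrA.
Unshelve. all: by end_near. Qed.

(** * The algebraic system satisfied by t and c at the observation *)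

(** A symmetrization of Chebyshev type: the expanded difference is added to its copy with i and j
    exchanged, and the summands then factor. *)
Lemma double_cross_sum {R : comPzRingType} {n : nat} (x l : 'I_n -> R) :
  2 * ((\sum_i x i) * (\sum_i x i ^+ 2 * l i)
       - (\sum_i x i * l i) * (\sum_i x i ^+ 2)) =
  \sum_i \sum_j x i * x j * ((x j - x i) * (l j - l i)).
Proof.
(* The second copy has its factors in the opposite order, so that expanding both copies produces the
   two index orders. *)
transitivity ((\sum_i x i) * (\sum_i x i ^+ 2 * l i)
  - (\sum_i x i * l i) * (\sum_i x i ^+ 2)
  + ((\sum_i x i ^+ 2 * l i) * (\sum_i x i)
  - (\sum_i x i ^+ 2) * (\sum_i x i * l i))); first by ring.
rewrite !big_distrlr -!sumrB -big_split; apply: eq_bigr => i _.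
rewrite -!sumrB -big_split; apply: eq_bigr => j _ /=; ring.
Qed.

Lemma powR_cross_sum_exponent {R : realType} {n : nat} (a : 'I_n -> R) (s : R) :
  (forall i, 0 < a i) -> (exists i j, a i != a j) ->
  (\sum_i a i `^ s) * (\sum_i (a i `^ s) ^+ 2 * ln (a i)) =
    (\sum_i a i `^ s * ln (a i)) * (\sum_i (a i `^ s) ^+ 2) ->
  s = 0.
Proof.
move=> a0 [i0 [j0 aij]] cross.
have := double_cross_sum (fun i => a i `^ s) (fun i => ln (a i)).
rewrite cross subrr mulr0 => /esym sum0.
apply/eqP/negPn/negP => s0.
pose F i j := a i `^ s * a j `^ s *
  ((a j `^ s - a i `^ s) * (s * ln (a j) - s * ln (a i))).
have F0 i j : 0 <= F i j.
  apply: mulr_ge0; first by rewrite mulr_ge0 ?powR_ge0.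
  rewrite /powR !(gt_eqF (a0 _)).
  have [le|/ltW le] := leP (s * ln (a i)) (s * ln (a j)).
    by rewrite mulr_ge0 ?subr_ge0 ?ler_expR.
  by rewrite mulr_le0 ?subr_le0 ?ler_expR.
have sumF0 : \sum_i \sum_j F i j = 0.
  transitivity (s * \sum_i \sum_j a i `^ s * a j `^ s *
      ((a j `^ s - a i `^ s) * (ln (a j) - ln (a i)))).
    rewrite mulr_sumr; apply: eq_bigr => i _.
    rewrite mulr_sumr; apply: eq_bigr => j _; rewrite /F; ring.
  by rewrite sum0 mulr0.
have /(_ i0 isT) Fi0 := psumr_eq0P (fun i _ => sumr_ge0 _ (fun j _ => F0 i j)) sumF0.
have /(_ j0 isT)/eqP := psumr_eq0P (fun j _ => F0 i0 j) Fi0.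
(* For the pair with distinct entries both differences are nonzero, by injectivity of [ln] and
   [expR], which contradicts the vanishing of its summand. *)
have lneq : s * ln (a j0) != s * ln (a i0).
  by rewrite (inj_eq (mulfI s0)) (inj_in_eq (@ln_inj R)) ?posrE// eq_sym.
have xneq : a j0 `^ s != a i0 `^ s.
  by rewrite /powR !(gt_eqF (a0 _)) (inj_eq (@expR_inj R)).
apply/negP; rewrite /F !mulf_eq0 !subr_eq0 (negbTE lneq) (negbTE xneq) !orbF.
by rewrite !gt_eqF// powR_gt0.
Qed.

(** The second equation keeps a factor [tau] because the Euler-Lagrange equation in c delivers it in
    that form. It can be cancelled: the first equation has a positive right-hand side, which forces
    [tau] to be nonzero. *)
Lemma stationaryP {R : realType} {n : nat} (a : 'I_n -> R) (kappa tau gamma : R) :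
  (forall i, 0 < a i) -> (exists i j, a i != a j) -> 0 < kappa ->
  (tau * (\sum_i (a i `^ (1 - gamma)) ^+ 2)
     = kappa * (\sum_i a i `^ (1 - gamma)) /\
   tau * (tau * (\sum_i (a i `^ (1 - gamma)) ^+ 2 * ln (a i)))
     = tau * (kappa * (\sum_i a i `^ (1 - gamma) * ln (a i)))) <->
  tau = kappa /\ gamma = 1.
Proof.
move=> a0 neq kappa0; split=> [[eq1 eq2]|[-> ->]]; last first.
  rewrite subrr; split; congr (_ * _); last congr (_ * _);
    by apply: eq_bigr => i _; rewrite powRr0 expr1n.
have [i0 _] := neq.
have sum_gt0 (F : 'I_n -> R) : (forall i, 0 < F i) -> 0 < \sum_i F i.
  move=> F0; rewrite (bigD1 i0)//= ltr_wpDr ?sumr_ge0// => i _; exact: ltW.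
have S1gt0 := sum_gt0 _ (fun i => powR_gt0 (1 - gamma) (a0 i)).
have S2gt0 := sum_gt0 _ (fun i => exprn_gt0 2 (powR_gt0 (1 - gamma) (a0 i))).
have tau0 : tau != 0.
  by apply: contra_eq_neq eq1 => ->; rewrite mul0r lt_eqF ?mulr_gt0.
have gamma1 : 1 - gamma = 0.
  apply: (powR_cross_sum_exponent a) => //.
  move/(mulfI tau0) : eq2 => eq2.
  (* After multiplication by kappa tau, each side of the cross-sum identity is a product of one side
     of each stationarity equation. *)
  apply: (mulfI (mulf_neq0 (lt0r_neq0 kappa0) tau0)).
  rewrite mulrACA -eq1 eq2; ring.
split; last by rewrite -[LHS](subKr 1) gamma1 subr0.
apply: (mulIf (lt0r_neq0 S1gt0)); rewrite -eq1; congr (_ * _).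
by apply: eq_bigr => i _; rewrite gamma1 powRr0 expr1n.
Qed.

(** * Optimality conditions and soft thresholding at the observation *)

Section observation.
Context {R : realType} {d : nat} (kappa : R) (z : 'rV[R]_d).
Hypotheses (kappa0 : 0 < kappa) (z0 : forall i, z 0 i != 0).

Let norm_gt0 i : 0 < `|z 0 i|. Proof. by rewrite normr_gt0. Qed.

Lemma optimality_conditionsP (t c : 'rV[R]_d -> R) :
  (exists i j, `|z 0 i| != `|z 0 j|) -> \sum_i ln `|z 0 i| != 0 ->
  optimality_conditions (laplace_pdf kappa) z t c <->
  t (vabs z) = kappa /\ c (vabs z) = 1.
Proof.
move=> neq lnz; rewrite /optimality_conditions.
set gamma := c (vabs z).
pose x i := `|z 0 i| `^ (1 - gamma).
have vabsE i : vabs z 0 i = `|z 0 i| by rewrite mxE.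
(* The sign in the sums meets the sign in the score, and their product is 1 since no coordinate
   vanishes. *)
have sgs i : Num.sg (z 0 i) * score (laplace_pdf kappa) (z 0 i) = - kappa.
  by rewrite score_laplace// mulrN mulrCA -expr2 sqr_sg z0 mulr1.
have x2E i : vabs z 0 i `^ (2 - 2 * gamma) = x i ^+ 2.
  rewrite vabsE (_ : 2 - 2 * gamma = (1 - gamma) * 2%:R); last by ring.
  by rewrite powRrM powR_mulrn// powR_ge0.
have S1E : \sum_i Num.sg (z 0 i) * vabs z 0 i `^ (1 - gamma)
    * score (laplace_pdf kappa) (z 0 i) = - kappa * \sum_i x i.
  by rewrite mulr_sumr; apply: eq_bigr => i _; rewrite vabsE mulrAC sgs.
have S1lnE : \sum_i Num.sg (z 0 i) * vabs z 0 i `^ (1 - gamma) * ln (vabs z 0 i)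
    * score (laplace_pdf kappa) (z 0 i) = - kappa * \sum_i x i * ln `|z 0 i|.
  rewrite mulr_sumr; apply: eq_bigr => i _.
  rewrite -(sgs i) vabsE -/(x i); ring.
have S2E : \sum_i vabs z 0 i `^ (2 - 2 * gamma) = \sum_i x i ^+ 2.
  by apply: eq_bigr => i _; rewrite x2E.
have S2lnE : \sum_i vabs z 0 i `^ (2 - 2 * gamma) * ln (vabs z 0 i)
    = \sum_i x i ^+ 2 * ln `|z 0 i|.
  by apply: eq_bigr => i _; rewrite x2E vabsE.
rewrite /= S1E S1lnE S2E S2lnE.
have [i0 _] := neq.
have sum_gt0 (F : 'I_d -> R) : (forall i, 0 < F i) -> 0 < \sum_i F i.
  move=> F0; rewrite (bigD1 i0)//= ltr_wpDr ?sumr_ge0// => i _; exact: ltW.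
have x0 i : 0 < x i by exact: powR_gt0.
have S1 := lt0r_neq0 (sum_gt0 _ x0).
have S2 := lt0r_neq0 (sum_gt0 _ (fun i => exprn_gt0 2 (x0 i))).
split=> [[tE cE]|tc].
  apply/(stationaryP (fun i => `|z 0 i|)) => //.
  have tS2 : t (vabs z) * (\sum_i x i ^+ 2) = kappa * \sum_i x i.
    by rewrite tE !mulNr opprK divfK.
  split=> //.
  (* As x / 0 = 0, a vanishing denominator would force S1 / S2 = 0. *)
  have S2ln0 : \sum_i x i ^+ 2 * ln `|z 0 i| != 0.
    apply: contra_eq_neq cE => ->.
    by rewrite invr0 mulr0 mulf_neq0 ?invr_eq0// mulf_neq0// oppr_eq0 lt0r_neq0.
  by congr (_ * _); rewrite tE cE !mulNr opprK divfK.
have [-> gamma1] := tc.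
(* At c = 1 all powers equal 1, so the denominator with logarithms becomes the sum of ln |z_i|,
   nonzero by [lnz]; both quotients are then - kappa. *)
have x1 i : x i = 1 by rewrite /x gamma1 subrr powRr0.
have S2x : \sum_i x i ^+ 2 = \sum_i x i.
  by apply: eq_bigr => i _; rewrite x1 expr1n.
have -> : \sum_i x i ^+ 2 * ln `|z 0 i| = \sum_i ln `|z 0 i|.
  by apply: eq_bigr => i _; rewrite x1 expr1n mul1r.
have -> : \sum_i x i * ln `|z 0 i| = \sum_i ln `|z 0 i|.
  by apply: eq_bigr => i _; rewrite x1 mul1r.
by rewrite S2x !mulfK// opprK.
Qed.

(** Writing z_i as its sign times |z_i| and moving |z_i| inside the maximum turns 1 - kappa / |z_i|
    into |z_i| - kappa. *)
Lemma gest_plus_laplace (t c : 'rV[R]_d -> R) :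
  t (vabs z) = kappa -> c (vabs z) = 1 ->
  gest_plus t c z = soft_threshold kappa z.
Proof.
move=> tE cE; apply/rowP => i; rewrite !mxE tE cE powRr1//.
rewrite {2}[z 0 i]numEsg mulrCA; congr (_ * _).
by rewrite maxr_pMl ?normr_ge0// mul0r mulrBl mul1r divfK// lt0r_neq0.
Qed.

Lemma soft_thresholdE : soft_threshold kappa z =
  hadamard (\row_i Num.max 0 (1 - kappa / `|z 0 i|)) z.
Proof.
rewrite -(@gest_plus_laplace (cst kappa) (cst 1))//.
by apply/rowP => i; rewrite !mxE powRr1.
Qed.

End observation.

(** * The Euler-Lagrange equations at the observation *)

Section radial_stationarity.
Context {R : realType} {d : nat}.
Implicit Types (f : R -> R) (z w p q : 'rV[R]_d) (t c : 'rV[R]_d -> R).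

Let gauss f z w : R := \prod_j normal_pdf 0 1 (w 0 j - z 0 j - score f (z 0 j)).

(** Only the i-th summand involves the i-th entry of p, and linearly. The result contains neither p
    nor q, so the outer radial derivative differentiates t and c only once. *)
Lemma derive_lagrangian_p f z w tau gamma p q (i : 'I_d) :
  'D_(basis_vec i) (fun p => risk_lagrangian f z w tau gamma p q) p =
  - (2 * (`|w 0 i| * (`|w 0 i| `^ gamma)^-1)) * gauss f z w.
Proof.
apply: derive_affine => h; rewrite /risk_lagrangian -/(gauss f z w).
rewrite (bigD1 i)//= [in RHS](bigD1 i)//= !mxE !eqxx /= mulr1.
under eq_bigr => j ji do rewrite !mxE (negbTE ji) mulr0 add0r.
ring.
Qed.

Lemma derive_lagrangian_q f z w tau gamma p q (i : 'I_d) :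
  'D_(basis_vec i) (fun q => risk_lagrangian f z w tau gamma p q) q =
  2 * (tau * ln `|w 0 i| * (`|w 0 i| * (`|w 0 i| `^ gamma)^-1)) * gauss f z w.
Proof.
apply: derive_affine => h; rewrite /risk_lagrangian -/(gauss f z w).
rewrite (bigD1 i)//= [in RHS](bigD1 i)//= !mxE !eqxx /= mulr1.
under eq_bigr => j ji do rewrite !mxE (negbTE ji) mulr0 add0r.
ring.
Qed.

Variables (kappa : R) (z : 'rV[R]_d).
Hypotheses (kappa0 : 0 < kappa) (z0 : forall i, z 0 i != 0).

Let f := laplace_pdf kappa.
Let a := vabs z.
Let phi := gauss f z z.

Let aE i : a 0 i = `|z 0 i|. Proof. by rewrite mxE. Qed.
Let a0 i : 0 < a 0 i. Proof. by rewrite aE normr_gt0. Qed.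

Let phi0 : phi != 0.
Proof.
apply/prodf_neq0 => j _; rewrite normal_pdfE ?oner_eq0//.
by rewrite mulf_neq0// lt0r_neq0 ?expR_gt0// normal_peak_gt0 ?oner_eq0.
Qed.

(** At z the i-th Gaussian argument is - l'(z_i) = kappa sgn z_i; a radial step h makes it (kappa +
    h) sgn z_i, and completing the square gives the exponent. At h = 0 its derivative is - kappa. *)
Let gauss_radial (i : 'I_d) (h : R) :
  gauss f z (h *: radial_dir z i + z) =
  phi * expR (- (h ^+ 2 / 2 + kappa * h)).
Proof.
rewrite /phi /gauss (bigD1 i)//= [in RHS](bigD1 i)//= [RHS]mulrAC; congr (_ * _).
  rewrite !mxE !eqxx mulr1 !normal_pdfE ?oner_eq0//.
  rewrite -[LHS]/(normal_peak 1 * normal_fun 0 1 _).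
  rewrite -[X in _ = X * _]/(normal_peak 1 * normal_fun 0 1 _) -mulrA.
  rewrite /normal_fun -expRD; congr (_ * expR _).
  rewrite score_laplace//.
  have s2 : Num.sg (z 0 i) * Num.sg (z 0 i) = 1 by rewrite -expr2 sqr_sg z0.
  move: s2; set s := Num.sg _ => s2.
  apply/eqP; rewrite -subr_eq0; apply/eqP.
  (* The two exponents agree only because s^2 = 1, so their difference is written as a multiple of 1
     - s^2. *)
  transitivity ((1 - s * s) * (h ^+ 2 / 2 + h * kappa)); first by field.
  by rewrite s2 subrr mul0r.
apply: eq_bigr => j ji; rewrite !mxE eqxx/= (negbTE ji) !mulr0 add0r//.
Qed.

(** As long as h > - |z_i| the displaced coordinate keeps its sign, so a radial step of z is a step
    of |z| along the i-th basis vector. *)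
Let vabs_radial (i : 'I_d) : \forall h \near (0 : R),
  [/\ 0 < a 0 i + h, `|(h *: radial_dir z i + z) 0 i| = a 0 i + h &
     vabs (h *: radial_dir z i + z) = h *: basis_vec i + a].
Proof.
near=> h.
have h_gt : 0 < a 0 i + h.
  rewrite -ltrBlDl sub0r; near: h.
  by apply: lt_nbhsr; rewrite oppr_lt0.
have vE : vabs (h *: radial_dir z i + z) = h *: basis_vec i + a.
  apply/rowP => j; rewrite !mxE eqxx/=.
  have [->|ji] := eqVneq j i; last by rewrite !mulr0 !add0r.
  rewrite !mulr1 {2}[z 0 i]numEsg [_ * `|_|]mulrC -mulrDl normrM normr_sg z0 mulr1.
  by rewrite gtr0_norm// addrC -aE.
split=> //; move/rowP/(_ i) : vE; rewrite [LHS]mxE => ->.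
by rewrite !mxE !eqxx mulr1 addrC.
Unshelve. all: by end_near. Qed.

Section partials.
Variables t c : 'rV[R]_d -> R.
Hypotheses (dt : has_partials t a) (dc : has_partials c a).

Let line (g : 'rV[R]_d -> R) (i : 'I_d) : has_partials g a ->
  is_derive (0 : R) 1 (fun h => g (h *: basis_vec i + a)) (grad g a 0 i).
Proof. by move=> /(_ i)/derivableP dg; rewrite mxE; exact/(is_derive_line g). Qed.

Let E i : R := (a 0 i `^ c a)^-1.

(** The radial derivative at z of |z_i|^(1-c) times the Gaussian factor, divided by the value [phi]
    of that factor. *)
Let radial_factor i := E i * (1 - c a - a 0 i * ln (a 0 i) * grad c a 0 i - kappa * a 0 i).

Let EE i : expR (- (c a * ln (a 0 i))) = E i.
Proof. by rewrite expRN /E /powR gt_eqF. Qed.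

Let radial i : is_derive (0 : R) 1
  (fun h => `|(h *: radial_dir z i + z) 0 i|
    * (`|(h *: radial_dir z i + z) 0 i| `^ c (vabs (h *: radial_dir z i + z)))^-1
    * gauss f z (h *: radial_dir z i + z))
  (radial_factor i * phi).
Proof.
have := is_derive_radial _ kappa _ _ (a0 i) (line c i dc).
rewrite scale0r add0r EE => dF.
have := is_deriveZ phi dF.
rewrite [_ *: _]mulrC; apply: near_eq_is_derive.
near=> h.
have [ah absE vE] : [/\ 0 < a 0 i + h,
    `|(h *: radial_dir z i + z) 0 i| = a 0 i + h &
    vabs (h *: radial_dir z i + z) = h *: basis_vec i + a].
  by near: h; exact: vabs_radial.
rewrite absE vE gauss_radial /powR gt_eqF// -expRN.
by rewrite -[LHS]/(phi * _); ring.
Unshelve. all: by end_near. Qed.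

Lemma derive_radial_p i :
  'D_(radial_dir z i) (fun w => 'D_(basis_vec i)
    (fun p => risk_lagrangian f z w (t (vabs w)) (c (vabs w)) p (grad c (vabs w)))
    (grad t (vabs w))) z = - 2 * radial_factor i * phi.
Proof.
under eq_fun do rewrite derive_lagrangian_p.
apply: derive_val; apply/is_derive_line.
have := is_deriveZ (- 2) (radial i).
rewrite -[X in is_derive _ _ _ X]/(-2 * (radial_factor i * phi)) mulrA.
apply: near_eq_is_derive; near=> h.
by rewrite -[LHS]/(-2 * _); ring.
Unshelve. all: by end_near. Qed.

(** Compared with the derivative in p, the factor t ln |z_i| appears, so the product rule adds a
    term with the partial derivative of t. *)
Lemma derive_radial_q i :
  'D_(radial_dir z i) (fun w => 'D_(basis_vec i)
    (fun q => risk_lagrangian f z w (t (vabs w)) (c (vabs w)) (grad t (vabs w)) q)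
    (grad c (vabs w))) z =
  2 * (t a * ln (a 0 i) * radial_factor i
    + a 0 i * E i * (grad t a 0 i * ln (a 0 i) + t a / a 0 i)) * phi.
Proof.
under eq_fun do rewrite derive_lagrangian_q.
apply: derive_val; apply/is_derive_line.
have dln : is_derive (0 : R) 1 (fun h => ln (a 0 i + h)) (a 0 i)^-1.
  exact: is_derive_ln_shift.
have := is_deriveZ 2 (is_deriveM (is_deriveM (line t i dt) dln) (radial i)).
set F := (F in is_derive _ _ F _ -> _); set y := (y in is_derive _ _ _ y -> _).
have -> : y = 2 * (t a * ln (a 0 i) * radial_factor i
    + a 0 i * E i * (grad t a 0 i * ln (a 0 i) + t a / a 0 i)) * phi.
  rewrite /y.
  transitivity (2 * (t (0 *: basis_vec i + a) * ln (a 0 i + 0) * (radial_factor i * phi)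
    + `|(0 *: radial_dir z i + z) 0 i|
    * (`|(0 *: radial_dir z i + z) 0 i| `^ c (vabs (0 *: radial_dir z i + z)))^-1
    * gauss f z (0 *: radial_dir z i + z)
    * (t (0 *: basis_vec i + a) * (a 0 i)^-1 + ln (a 0 i + 0) * grad t a 0 i))) => //.
  rewrite !scale0r !add0r addr0 -/phi -/a -aE -/(E i); ring.
apply: near_eq_is_derive; near=> h.
have [_ absE vE] : [/\ 0 < a 0 i + h,
    `|(h *: radial_dir z i + z) 0 i| = a 0 i + h &
    vabs (h *: radial_dir z i + z) = h *: basis_vec i + a].
  by near: h; exact: vabs_radial.
rewrite -[LHS]/(2 * (t (h *: basis_vec i + a) * ln (a 0 i + h) * _)) -vE absE; ring.
Unshelve. all: by end_near. Qed.

Let powR_a2 i : a 0 i `^ 2 = a 0 i ^+ 2.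
Proof. by rewrite -powR_mulrn// ltW. Qed.

(** The Lagrangian is quadratic in [tau]; its leading coefficient uses |z_i|^(2-c) = a_i^2 E_i. *)
Let derive_tau : derive1 (fun tau =>
    risk_lagrangian f z z tau (c a) (grad t a) (grad c a)) (t a) =
  - (\sum_i E i * (- 2 * a 0 i * ln (a 0 i) * grad c a 0 i + 2 * (1 - c a)
                   - 2 * t a * a 0 i ^+ 2 * E i)) * phi.
Proof.
rewrite derive1E.
have dterm i := is_deriveZ (E i) (is_derive_quadratic (2 * a 0 i * grad t a 0 i)
  (- 2 * a 0 i * ln (a 0 i) * grad c a 0 i + 2 * (1 - c a))
  (- (a 0 i ^+ 2 * E i)) (t a)).
have := is_deriveZ (- phi) (is_derive_sum_fun _ _ _ dterm).
set F := (F in is_derive _ _ F _ -> _); set y := (y in is_derive _ _ _ y -> _).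
have -> : F = (fun tau => risk_lagrangian f z z tau (c a) (grad t a) (grad c a)).
  apply/funext => tau; rewrite /risk_lagrangian -/(gauss f z z) -/phi.
  rewrite mulNr mulrC -mulNr; congr (_ * _); apply: eq_bigr => i _.
  by rewrite -aE powRB ?(gt_eqF (a0 i)) ?implybT// powR_a2 -/(E i);
    rewrite -[LHS]/(E i * (_ + _ * tau + _ * tau ^+ 2)); ring.
move=> dL; rewrite derive_val /y -[LHS]/(- phi * _) mulNr mulrC -mulNr; congr (- _ * _).
by apply: eq_bigr => i _; rewrite -[LHS]/(E i * _); ring.
Qed.

Let derive_gamma : derive1 (fun gamma =>
    risk_lagrangian f z z (t a) gamma (grad t a) (grad c a)) (c a) =
  - (\sum_i (- ln (a 0 i) * E i * (2 * a 0 i * grad t a 0 i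
      - 2 * t a * a 0 i * ln (a 0 i) * grad c a 0 i + 2 * t a * (1 - c a))
      - 2 * t a * E i + 2 * ln (a 0 i) * t a ^+ 2 * (a 0 i * E i) ^+ 2)) * phi.
Proof.
rewrite derive1E.
have dterm i := is_derive_powR_term _ (2 * a 0 i * grad t a 0 i
  - 2 * t a * a 0 i * ln (a 0 i) * grad c a 0 i) (t a) (c a) (a0 i).
have := is_deriveZ (- phi) (is_derive_sum_fun _ _ _ dterm).
set F := (F in is_derive _ _ F _ -> _); set y := (y in is_derive _ _ _ y -> _).
have -> : F = (fun gamma => risk_lagrangian f z z (t a) gamma (grad t a) (grad c a)).
  apply/funext => gamma; rewrite /risk_lagrangian -/(gauss f z z) -/phi.
  rewrite mulNr mulrC -mulNr; congr (_ * _); apply: eq_bigr => i _.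
  by rewrite -aE.
by move=> dL; rewrite derive_val /y -[LHS]/(- phi * _) mulNr mulrC mulrN.
Qed.

Let xE i : a 0 i `^ (1 - c a) = a 0 i * E i.
Proof. by rewrite powRB ?(gt_eqF (a0 i)) ?implybT// powRr1// ltW. Qed.

Lemma euler_lagrangeP : (exists i j, `|z 0 i| != `|z 0 j|) ->
  euler_lagrange f z t c <-> t a = kappa /\ c a = 1.
Proof.
move=> [i0 [j0 neq]].
have -> : euler_lagrange f z t c =
  (- (\sum_i E i * (- 2 * a 0 i * ln (a 0 i) * grad c a 0 i
      + 2 * (1 - c a) - 2 * t a * a 0 i ^+ 2 * E i)) * phi
     = \sum_i (- 2 * radial_factor i * phi) /\
   - (\sum_i (- ln (a 0 i) * E i * (2 * a 0 i * grad t a 0 i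
      - 2 * t a * a 0 i * ln (a 0 i) * grad c a 0 i + 2 * t a * (1 - c a))
      - 2 * t a * E i + 2 * ln (a 0 i) * t a ^+ 2 * (a 0 i * E i) ^+ 2)) * phi
     = \sum_i (2 * (t a * ln (a 0 i) * radial_factor i
      + a 0 i * E i * (grad t a 0 i * ln (a 0 i) + t a / a 0 i)) * phi)).
  rewrite /euler_lagrange; apply: (f_equal2 and); apply: (f_equal2 eq).
  - exact: derive_tau.
  - by apply: eq_bigr => i _; exact: derive_radial_p.
  - exact: derive_gamma.
  - by apply: eq_bigr => i _; exact: derive_radial_q.
have neq' : exists i j, a 0 i != a 0 j by exists i0, j0; rewrite !aE.
apply: iff_trans (stationaryP (fun i => a 0 i) kappa (t a) (c a) a0 neq' kappa0).
(* The gradient of c and the terms in 1 - c cancel between the two sides, leaving a multiple of the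
   first stationarity equation. *)
have diff1 : - (\sum_i E i * (- 2 * a 0 i * ln (a 0 i) * grad c a 0 i
      + 2 * (1 - c a) - 2 * t a * a 0 i ^+ 2 * E i)) * phi
    - \sum_i (- 2 * radial_factor i * phi) =
  2 * phi * (t a * (\sum_i (a 0 i `^ (1 - c a)) ^+ 2)
    - kappa * (\sum_i a 0 i `^ (1 - c a))).
  rewrite -sumrN mulr_suml -sumrB [RHS]mulrBr !mulr_sumr -sumrB.
  by apply: eq_bigr => i _; rewrite xE /radial_factor; ring.
(* Here the gradients of both t and c cancel, and what remains carries the extra factor t present in
   [stationaryP]. *)
have diff2 : - (\sum_i (- ln (a 0 i) * E i * (2 * a 0 i * grad t a 0 i
      - 2 * t a * a 0 i * ln (a 0 i) * grad c a 0 i + 2 * t a * (1 - c a))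
      - 2 * t a * E i + 2 * ln (a 0 i) * t a ^+ 2 * (a 0 i * E i) ^+ 2)) * phi
    - \sum_i (2 * (t a * ln (a 0 i) * radial_factor i
      + a 0 i * E i * (grad t a 0 i * ln (a 0 i) + t a / a 0 i)) * phi) =
  - 2 * phi * (t a * (t a * (\sum_i (a 0 i `^ (1 - c a)) ^+ 2 * ln (a 0 i)))
    - t a * (kappa * (\sum_i a 0 i `^ (1 - c a) * ln (a 0 i)))).
  rewrite -sumrN mulr_suml -sumrB [RHS]mulrBr !mulr_sumr -sumrB.
  apply: eq_bigr => i _; rewrite xE /radial_factor; field; exact: lt0r_neq0.
have eq_of_diff (u v k x y : R) : k != 0 -> u - v = k * (x - y) -> (u = v <-> x = y).
  move=> k0 uv; split=> /eqP; rewrite -subr_eq0 => /eqP e; apply/eqP; rewrite -subr_eq0.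
    by move: uv; rewrite e => /esym/eqP; rewrite mulf_eq0 (negbTE k0).
  by rewrite uv e mulr0.
have two0 : (2 : R) != 0 by rewrite pnatr_eq0.
have mtwo0 : - (2 : R) != 0 by rewrite oppr_eq0.
have [e1 e1'] := eq_of_diff _ _ _ _ _ (mulf_neq0 two0 phi0) diff1.
have [e2 e2'] := eq_of_diff _ _ _ _ _ (mulf_neq0 mtwo0 phi0) diff2.
by split=> -[? ?]; split; auto.
Qed.

End partials.
End radial_stationarity.

(** * Integrability of product functions on tuples *)

Lemma measurable_prod_tnth {R : realType} {n : nat} (g : 'I_n -> R -> R) :
  (forall i, measurable_fun setT (g i)) ->
  measurable_fun [set: n.-tuple R] (fun u => \prod_(i < n) g i (tnth u i)).
Proof.
move=> mg; apply: measurable_prod => i _.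
apply: (measurableT_comp (mg i)); exact: measurable_tnth.
Qed.

(** Induction on n: the measure on n+1 coordinates is the image of a product measure, so Tonelli
    splits off the first coordinate and leaves a product of two finite integrals. *)
Lemma integral_prod_tnth {R : realType} {n : nat} (g : 'I_n -> R -> R) :
  (forall i, measurable_fun setT (g i)) -> (forall i x, 0 <= g i x) ->
  (forall i, \int[lebesgue_measure]_x (g i x)%:E < +oo)%E ->
  (\int[lebesgue_tuple n]_u (\prod_(i < n) g i (tnth u i))%:E < +oo)%E.
Proof.
elim: n g => [|n IHn] g mg g0 goo.
  (* In dimension 0 the measure is a unit point mass, so the integral is a real value. *)
  rewrite /lebesgue_tuple/= integral_dirac//=; last first.
    by apply/measurable_EFinP; exact: measurable_prod_tnth.
  by rewrite diracT mul1e ltry.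
have mprod := measurable_prod_tnth _ mg.
have -> : lebesgue_tuple n.+1 = lebesgue_cons (lebesgue_tuple n) :> (set _ -> _) by [].
rewrite ge0_integral_pushforward; last 4 first.
- exact: measurable_tuple_cons.
- exact: measurableT.
- exact/measurable_EFinP.
- by move=> u _; rewrite lee_fin prodr_ge0.
rewrite preimage_setT fubini_tonelli1; last 2 first.
- apply/measurable_EFinP; apply: (measurableT_comp mprod).
  exact: measurable_tuple_cons.
- by move=> u; rewrite lee_fin prodr_ge0.
pose I := (\int[lebesgue_tuple n]_v (\prod_(i < n) g (lift ord0 i) (tnth v i))%:E)%E.
have Ioo : (I < +oo)%E.
  by apply: (IHn (fun i => g (lift ord0 i))) => i;
    [exact: mg|exact: g0|exact: goo].
have mI : measurable_fun [set: n.-tuple R]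
    (fun v : n.-tuple R => (\prod_(i < n) g (lift ord0 i) (tnth v i))%:E).
  apply/measurable_EFinP.
  exact: (measurable_prod_tnth (fun i => g (lift ord0 i))) (fun i => mg _).
have I0 : (0 <= I)%E.
  by apply: integral_ge0 => v _; rewrite lee_fin prodr_ge0.
rewrite [X in (X < _)%E](_ : _ =
    \int[lebesgue_measure]_x ((g ord0 x)%:E * I))%E; last first.
  apply: eq_integral => x _; rewrite /fubini_F.
  rewrite (eq_integral (fun v : n.-tuple R => (g ord0 x)%:E *
    (\prod_(i < n) g (lift ord0 i) (tnth v i))%:E)%E); last first.
    move=> v _; rewrite /= big_ord_recl EFinM; congr (_%:E * _%:E)%E.
    by apply: eq_bigr => i _; rewrite tnthS.
  rewrite ge0_integralZl_EFin// => v _; by rewrite lee_fin prodr_ge0.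
have mg0 : measurable_fun [set: R] (fun x => (g ord0 x)%:E).
  exact/measurable_EFinP.
rewrite ge0_integralZr//; last first.
  by move=> x _; rewrite lee_fin.
have g00 : (0 <= \int[lebesgue_measure]_x (g ord0 x)%:E)%E.
  by apply: integral_ge0 => x _; rewrite lee_fin.
by apply: lte_mul_pinfty => //; rewrite ge0_fin_numE.
Qed.

(** * Membership of the constant pair in the class *)

Section constant_class.
Context {R : realType} {d : nat}.

(* The factor |z_i|^-1 |z_i| is 1, except that it is 0 at z_i = 0. *)
Lemma Hhat_const1 (f : R -> R) (zobs z : 'rV[R]_d) (kappa : R) :
  Hhat f zobs (cst kappa) (cst 1) z =
  kappa ^+ 2 * (\sum_i `|z 0 i|^-1 * `|z 0 i|)
  * \prod_j normal_pdf 0 1 (z 0 j - zobs 0 j - score f (zobs 0 j)).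
Proof.
rewrite /Hhat /risk_lagrangian; congr (_ * _).
rewrite -sumrN mulr_sumr; apply: eq_bigr => i _.
rewrite !mxE !derive_cst /= powRr1// (_ : 2 - 1 = 1); last by ring.
by rewrite powRr1//; ring.
Qed.

(** Supplies the pair that realizes the NOMAD estimate. *)
Lemma gest_class_const1 (f : R -> R) (zobs : 'rV[R]_d) (kappa : R) :
  0 <= kappa -> gest_class f zobs (cst kappa, cst 1).
Proof.
move=> kappa0; split => /=.
- by move=> z; split.
- by apply: aeW => u; split=> i; exact: derivable_cst.
pose g (i : 'I_d) (x : R) := normal_pdf 0 1 (x - zobs 0 i - score f (zobs 0 i)).
have mg i : measurable_fun setT (g i).
  apply: (measurableT_comp (measurable_normal_pdf 0 1)).
  by do 2!apply: measurable_funB => //.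
have g0 i x : 0 <= g i x by exact: normal_pdf_ge0.
(* Recentred at [zobs 0 i + score f (zobs 0 i)], each factor is a normal density and has integral
   1. *)
have gE i : g i = normal_pdf (zobs 0 i + score f (zobs 0 i)) 1.
  apply/funext => x; rewrite /g !normal_pdfE ?oner_eq0//.
  rewrite -[LHS]/(normal_peak 1 * normal_fun 0 1 _).
  rewrite -[RHS]/(normal_peak 1 * normal_fun _ 1 x).
  by rewrite [in RHS]normal_fun_center /= opprD addrA.
have goo i : (\int[lebesgue_measure]_x (g i x)%:E < +oo)%E.
  by rewrite gE integral_normal_pdf ltry.
pose P (u : d.-tuple R) := \prod_(i < d) g i (tnth u i).
have P0 u : 0 <= P u by exact: prodr_ge0.
have mP : measurable_fun [set: d.-tuple R] P by exact: measurable_prod_tnth.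
have intP : (lebesgue_tuple d).-integrable setT
    (fun u => (kappa ^+ 2 * d%:R)%:E * (P u)%:E)%E.
  apply: integrableZl => //; apply/integrableP; split; first exact/measurable_EFinP.
  rewrite (eq_integral (fun u => (P u)%:E)); last first.
    by move=> u _; rewrite /= ger0_norm.
  exact: integral_prod_tnth.
apply: le_integrable intP => //.
  apply/measurable_EFinP.
  (* The inverse is written as the power -1, also at 0 where both are 0, so that measurability of
     [powR] applies. *)
  rewrite (_ : (fun u => _) = (fun u : d.-tuple R =>
    kappa ^+ 2 * (\sum_(i < d) `|tnth u i| `^ (-1) * `|tnth u i|) * P u)); last first.
    apply/funext => u; rewrite Hhat_const1; congr (_ * _ * _).
      by apply: eq_bigr => i _; rewrite mxE powR_inv1.
    by apply: eq_bigr => i _; rewrite /g mxE.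
  apply: measurable_funM => //; apply: measurable_funM => //.
  apply: measurable_sum => i.
  have mi : measurable_fun [set: d.-tuple R] (fun u => `|tnth u i|).
    by apply: measurableT_comp => //; exact: measurable_tnth.
  apply: measurable_funM => //.
  exact: (measurableT_comp (measurable_powR (-1)) mi).
move=> u _; rewrite Hhat_const1 lee_fin.
have -> : \prod_j normal_pdf 0 1 (row_of_tuple u 0 j - zobs 0 j - score f (zobs 0 j))
    = P u by apply: eq_bigr => i _; rewrite /g mxE.
rewrite !normrM ler_wpM2r// ler_wpM2l// ger0_norm; last first.
  by apply: sumr_ge0 => i _; rewrite mulr_ge0 ?invr_ge0.
rewrite ger0_norm// -[X in _ <= X%:R]card_ord -sumr_const.
(* Each summand is 0 or 1, so the sum is at most d. *)
apply: ler_sum => i _.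
have [->|x0] := eqVneq `|row_of_tuple u 0 i| 0; first by rewrite mulr0.
by rewrite mulVf.
Qed.

End constant_class.

(** Minimality enters through the optimality conditions: the fourth clause assumes that over [G]
    they are equivalent to minimizing the risk. The third clause derives the same pair from the
    Euler-Lagrange equations when t and c have partial derivatives at the observation. *)
Theorem proposition5 (R : realType) (d : nat) (kappa : R) (f : R -> R)
    (z : 'rV[R]_d) :
  0 < kappa ->
  f =1 laplace_pdf kappa ->
  generic_observation z ->
  [/\ forall x : R, x != 0 -> score f x = - (kappa * Num.sg x),
      forall t c : 'rV[R]_d -> R, gest_class f z (t, c) ->
        (optimality_conditions f z t c <->
         t (vabs z) = kappa /\ c (vabs z) = 1),
      forall t c : 'rV[R]_d -> R, gest_class f z (t, c) ->
        has_partials t (vabs z) -> has_partials c (vabs z) ->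
        (euler_lagrange f z t c <->
         t (vabs z) = kappa /\ c (vabs z) = 1),
      forall G : set (('rV[R]_d -> R) * ('rV[R]_d -> R)),
        G `<=` gest_class f z ->
        (forall t c : 'rV[R]_d -> R, G (t, c) ->
          (risk_minimizer f z G t c <-> optimality_conditions f z t c)) ->
        forall t c : 'rV[R]_d -> R, G (t, c) ->
        (risk_minimizer f z G t c <->
         t (vabs z) = kappa /\ c (vabs z) = 1) &
      (forall t c : 'rV[R]_d -> R,
        t (vabs z) = kappa -> c (vabs z) = 1 ->
        gest_plus t c z = soft_threshold kappa z) /\
      (forall th : 'rV[R]_d,
        nomad_estimate f z th <-> th = soft_threshold kappa z) /\
      soft_threshold kappa z =
        hadamard (\row_i Num.max 0 (1 - kappa / `|z 0 i|)) z].
Proof.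
move=> kappa0 /funext-> [z0 neq lnz].
have opt t c := optimality_conditionsP kappa z kappa0 z0 t c neq lnz.
have plus t c := gest_plus_laplace kappa z z0 t c.
split.
- by move=> x; exact: score_laplace.
- by move=> t c _; exact: opt.
- by move=> t c _ dt dc; exact: euler_lagrangeP.
- move=> G _ minP t c Gtc; exact: iff_trans (minP _ _ Gtc) (opt t c).
split=> //; split; last exact: soft_thresholdE.
move=> th; split=> [[t [c [_ /opt[tE cE] ->]]]|->]; first exact: plus.
(* Constant functionals take the values kappa and 1 at |z| and belong to the class. *)
exists (cst kappa), (cst 1); split; last by rewrite plus.
  exact/gest_class_const1/ltW.
exact/opt.
Qed.
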